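(* Let $\mathcal X,\mathcal Y$ be real Banach spaces and consider mappings $P\colon\mathcal P\to\mathcal X$ and $M\colon X\to\mathcal Y$, where $\mathcal P\subset\mathbb R^{\mathbb N^*}$ and $X\subset\mathcal X$ are open and $P(\mathcal P)\subset X$ holds. Furthermore, consider a parameter $\boldsymbol y_0\in\mathcal P$ and set $x_0:=P(\boldsymbol y_0)$. Assume in addition that, for some $s_P,s_M\in\mathbb R_{\ge1}$, $P$ has $s_P$-Gevrey mixed partial derivatives of arbitrary order at $\boldsymbol y_0$ with weight $\boldsymbol\gamma\in\mathbb R^{\mathbb N^*}$ and $M$ is $s_M$-Gevrey at $x_0$, i.e. there are open neighbourhoods $N_P\subset\mathcal P$ of $\boldsymbol y_0$ and $N_M\subset X$ of $x_0$ and constants $\mu_P,\nu_P,\mu_M,\nu_M\in\mathbb R_{\ge0}$ such that $$\forall\boldsymbol\alpha\in\mathbb N_f^{\mathbb N^*}\setminus\{\boldsymbol 0\}:\quad \sup_{\boldsymbol y\in N_P}\|\partial^{\boldsymbol\alpha}P(\boldsymbol y)\|_{\mathcal X}\le(|\boldsymbol\alpha|!)^{s_P}\mu_P\,\nu_P^{|\boldsymbol\alpha|}\boldsymbol\gamma^{\boldsymbol\alpha}$$ and $$\forall n\in\mathbb N^*:\quad \sup_{x\in N_M}\|\mathrm D^nM(x)\|_{\mathcal B^n(\mathcal X;\mathcal Y)}\le(n!)^{s_M}\mu_M\nu_M^n$$ hold. Then $Q:=M\circ P\colon\mathcal P\to\mathcal Y$ has $s$-Gevrey mixed partial derivatives of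 arbitrary order at $\boldsymbol y_0$ with weight $\boldsymbol\gamma$ for $s:=\max\{s_P,s_M\}$. Specifically, for $N:=N_P\cap P^{-1}(N_M)$ and $$\mu=\mu_M\,\frac{\nu_M\mu_P}{\nu_M\mu_P+1}\quad\text{and}\quad \nu=(\nu_M\mu_P+1)\,\nu_P,$$ we have $$\forall\boldsymbol\alpha\in\mathbb N_f^{\mathbb N^*}\setminus\{\boldsymbol0\}:\quad \sup_{\boldsymbol y\in N}\|\partial^{\boldsymbol\alpha}Q(\boldsymbol y)\|_{\mathcal Y}\le(|\boldsymbol\alpha|!)^{s}\mu\,\nu^{|\boldsymbol\alpha|}\boldsymbol\gamma^{\boldsymbol\alpha}.$$
   Context: $\mathbb N=\{0,1,\dots\}$, $\mathbb N^*=\{1,2,\dots\}$. $\mathbb N_f^{\mathbb N^*}$ is the set of finitely supported sequences (multi-indices) $\boldsymbol\alpha=(\alpha_n)_{n\in\mathbb N^*}$ of natural numbers; $|\boldsymbol\alpha|=\sum_n\alpha_n$ and $\boldsymbol\gamma^{\boldsymbol\alpha}=\prod_{n:\alpha_n\ne0}\gamma_n^{\alpha_n}$. $\partial^{\boldsymbol\alpha}$ is the mixed partial derivative of order $\alpha_n$ in the coordinate $y_n$ for each $n$. $\mathcal B^n(\mathcal X;\mathcal Y)$ is the Banach space of bounded $n$-linear maps from $\mathcal X$ to $\mathcal Y$; $\mathrm D^n$ is the $n$-th Fréchet derivative. In general, a map $F$ into a Banach space $\mathcal Z$, defined on an open set $\mathcal P\subset\mathbb R^{\mathbb N^*}$,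 has $s$-Gevrey mixed partial derivatives of arbitrary order at $\boldsymbol y_0\in\mathcal P$ with weight $\boldsymbol\gamma$ if there are an open neighbourhood $N_F\subset\mathcal P$ of $\boldsymbol y_0$ and constants $\mu_F,\nu_F\ge0$ such that the mixed partial derivatives exist on $N_F$ and $\sup_{\boldsymbol y\in N_F}\|\partial^{\boldsymbol\alpha}F(\boldsymbol y)\|_{\mathcal Z}\le(|\boldsymbol\alpha|!)^s\mu_F\nu_F^{|\boldsymbol\alpha|}\boldsymbol\gamma^{\boldsymbol\alpha}$ for all $\boldsymbol\alpha\in\mathbb N_f^{\mathbb N^*}\setminus\{\boldsymbol0\}$. Likewise, $M$ being $s_M$-Gevrey at $x_0$ includes that $M$ is infinitely Fréchet differentiable on $N_M$.
   Formalization: That Q has s-Gevrey mixed partial derivatives at y_0 (on an open neighbourhood) is proved assuming P is continuous at y_0, without which it can fail; the existence of the mixed partials and the explicit bound on N = N_P ∩ P^{-1}(N_M) need no such assumption. *)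

(* Defs.v *)
From HB Require Import structures.
From mathcomp Require Import all_boot all_order all_algebra finmap.
From mathcomp Require Import all_classical all_reals all_analysis.

Set Implicit Arguments.
Unset Strict Implicit.
Unset Printing Implicit Defensive.

Import Order.TTheory GRing.Theory Num.Theory.
Import numFieldNormedType.Exports.

Local Open Scope classical_set_scope.
Local Open Scope ring_scope.

Section BoundedMultilinear.
Context {R : realType} (n : nat) (X Y : normedModType R).
Implicit Types (A : ('I_n -> X) -> Y) (h : 'I_n -> X).

Definition multilinear A := forall (i : 'I_n) h (a : R) (u v : X),
  A (dfwith h i (a *: u + v)) = a *: A (dfwith h i u) + A (dfwith h i v).

Definition bounded_multilinear : set (('I_n -> X) -> Y) :=
  [set A | multilinear A /\
    exists C : R, forall h, `|A h| <= C * \prod_(i < n) `|h i|].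

Definition bmultilin_pred : {pred ('I_n -> X) -> Y} := mem bounded_multilinear.

Record bmultilin := BMultilin {
  bmultilin_fun :> ('I_n -> X) -> Y;
  bmultilin_funP : bmultilin_fun \in bmultilin_pred }.

HB.instance Definition _ := [isSub for bmultilin_fun].
HB.instance Definition _ := [Choice of bmultilin by <:].

Lemma bmultilin_submod_closed : submod_closed bmultilin_pred.
Proof.
have E0 h : (0 : ('I_n -> X) -> Y) h = 0 by [].
split.
  rewrite inE/=; split; first by move=> i h a u v; rewrite !E0 scaler0 addr0.
  by exists 0 => h; rewrite E0 normr0 mul0r.
move=> a A B; rewrite !inE/= => -[mA [C hC]] [mB [D hD]]; split.
  move=> i h b u v; rewrite !fctE mA mB !scalerDr !scalerA (mulrC a b).
  by rewrite addrACA.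
exists (`|a| * C + D) => h; rewrite !fctE (le_trans (ler_normD _ _))// mulrDl.
by rewrite lerD// normrZ -mulrA ler_wpM2l.
Qed.

HB.instance Definition _ :=
  GRing.isSubmodClosed.Build R _ bmultilin_pred bmultilin_submod_closed.
HB.instance Definition _ := [SubChoice_isSubLmodule of bmultilin by <:].

Definition bmultilin_norm (A : bmultilin) : R :=
  sup [set `|A h| | h in [set h : 'I_n -> X | forall i, `|h i| <= 1]].

Lemma multilinearZ A (c : 'I_n -> R) h : multilinear A ->
  A (fun i => c i *: h i) = (\prod_i c i) *: A h.
Proof.
move=> mA.
have step : forall (i : 'I_n) h a u,
    A (dfwith h i (a *: u)) = a *: A (dfwith h i u).
  move=> i g a u.
  have z : A (dfwith g i 0) = 0.
    by have := mA i g (-1) 0 0; rewrite scaler0 addr0 scaleN1r addNr.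
  by rewrite -[a *: u]addr0 mA z addr0.
suff H : forall s : seq 'I_n, uniq s ->
    A (fun i => if i \in s then c i *: h i else h i) =
    (\prod_(i <- s) c i) *: A h.
  have -> : \prod_i c i = \prod_(i <- enum 'I_n) c i by rewrite big_enum.
  rewrite -(H (enum 'I_n)) ?enum_uniq//; congr A; apply/funext => i.
  by rewrite mem_enum.
elim=> [_|i s IH /= /andP[iNs us]].
  by rewrite big_nil scale1r; congr A; apply/funext => i.
rewrite big_cons -scalerA -IH//.
set g := (fun j => if j \in s then _ else _).
have -> : g = dfwith g i (h i).
  by apply/funext => j; case: dfwithP => //; rewrite /g (negPf iNs).
rewrite -step; congr A; apply/funext => j.
case: dfwithP => [|k ik]; first by rewrite inE eqxx.
by rewrite inE eq_sym (negPf ik).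
Qed.

Lemma bmultilin_has_sup (A : bmultilin) :
  has_sup [set `|A h| | h in [set h : 'I_n -> X | forall i, `|h i| <= 1]].
Proof.
split; first by exists `|A (fun=> 0)|, (fun=> 0) => // i; rewrite normr0.
have := bmultilin_funP A; rewrite inE => -[_ [C hC]].
exists `|C| => _ [h h1 <-]; rewrite (le_trans (hC h))//.
rewrite (le_trans (ler_norm _))// normrM ler_piMr// ger0_norm ?prodr_ge0//.
by apply: prodr_ile1 => i _; rewrite normr_ge0 h1.
Qed.

Lemma bmultilin_norm_ub (A : bmultilin) h :
  (forall i, `|h i| <= 1) -> `|A h| <= bmultilin_norm A.
Proof.
move=> h1; apply: (ub_le_sup (proj2 (bmultilin_has_sup A))); by exists h.
Qed.

Lemma bmultilin_norm_le (A : bmultilin) (C : R) :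
  (forall h, (forall i, `|h i| <= 1) -> `|A h| <= C) -> bmultilin_norm A <= C.
Proof.
move=> hC; apply: ge_sup; first exact: (proj1 (bmultilin_has_sup A)).
by move=> _ [h h1 <-]; exact: hC.
Qed.

Lemma bmultilin_norm_ge0 (A : bmultilin) : 0 <= bmultilin_norm A.
Proof.
by apply: le_trans (@bmultilin_norm_ub A (fun=> 0) _) => // i; rewrite normr0.
Qed.

Lemma bmultilin_normP (A : bmultilin) h :
  `|A h| <= bmultilin_norm A * \prod_(i < n) `|h i|.
Proof.
have := bmultilin_funP A; rewrite inE => -[mA _].
have -> : (A : _ -> _) h = (\prod_i `|h i|) *: A (fun i => `|h i|^-1 *: h i).
  rewrite -(multilinearZ (fun i => `|h i|))//; congr bmultilin_fun.
  apply/funext => i; have [->|hi0] := eqVneq (h i) 0; first by rewrite !scaler0.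
  by rewrite scalerA divff ?normr_eq0// scale1r.
rewrite normrZ ger0_norm ?prodr_ge0// mulrC ler_wpM2r ?prodr_ge0//.
apply: bmultilin_norm_ub => i; rewrite normrZ normfV normr_id.
have [->|hi0] := eqVneq (h i) 0; first by rewrite normr0 mulr0.
by rewrite mulVf ?normr_eq0.
Qed.

Lemma bmultilin_normD (A B : bmultilin) :
  bmultilin_norm (A + B) <= bmultilin_norm A + bmultilin_norm B.
Proof.
apply: bmultilin_norm_le => h h1; rewrite /= fctE (le_trans (ler_normD _ _))//.
by rewrite lerD ?bmultilin_norm_ub.
Qed.

Lemma bmultilin_normZ (a : R) (A : bmultilin) :
  bmultilin_norm (a *: A) = `|a| * bmultilin_norm A.
Proof.
have le b B : bmultilin_norm (b *: B) <= `|b| * bmultilin_norm B.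
  apply: bmultilin_norm_le => h h1.
  by rewrite /= fctE normrZ ler_wpM2l ?bmultilin_norm_ub.
apply/eqP; rewrite eq_le le/=; have [->|a0] := eqVneq a 0.
  by rewrite normr0 mul0r bmultilin_norm_ge0.
rewrite mulrC -ler_pdivlMr ?normr_gt0// mulrC -normfV.
by rewrite -{1}[A](scalerK a0) le.
Qed.

Lemma bmultilin_norm_eq0 (A : bmultilin) : bmultilin_norm A = 0 -> A = 0.
Proof.
move=> A0; apply/val_inj/funext => h /=.
by apply/normr0_eq0/eqP; rewrite eq_le normr_ge0 andbT -(mul0r (\prod_i `|h i|))
  -A0 bmultilin_normP.
Qed.

HB.instance Definition _ := Lmodule_isNormed.Build R bmultilin
  bmultilin_normD bmultilin_normZ bmultilin_norm_eq0.

(** [A] itself when it is bounded and multilinear, and 0 otherwise. *)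
Definition to_bmultilin (A : ('I_n -> X) -> Y) : bmultilin := insubd 0 A.

End BoundedMultilinear.

(** [frechetD f n x] is D^n f(x) in B^n(X; Y), with the identification
    D^{n+1} f(x)(h_0, ..., h_n) = (D(D^n f)(x) h_0)(h_1, ..., h_n), where D is
    the Fréchet derivative of the B^n(X; Y)-valued map D^n f, and
    B^0(X; Y) = Y.  By [frechetDSE], the default value of [to_bmultilin] is
    never reached at points where D^n f is differentiable. *)
Fixpoint frechetD {R : realType} {X Y : normedModType R} (f : X -> Y) (n : nat)
    : X -> bmultilin n X Y :=
  match n with
  | 0 => fun x => to_bmultilin (fun=> f x)
  | m.+1 => fun x => to_bmultilin
      (fun h => 'd (frechetD f m) x (h ord0) (fun i => h (lift ord0 i)))
  end.

Definition smooth_on {R : realType} {X Y : normedModType R} (N : set X)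
    (f : X -> Y) := forall n x, N x -> differentiable (frechetD f n) x.

Section FrechetFacts.
Context {R : realType} {X Y : normedModType R} (f : X -> Y).

Lemma to_bmultilinE n (A : ('I_n -> X) -> Y) :
  bounded_multilinear A -> to_bmultilin A = A :> (_ -> _).
Proof. by move=> bA; rewrite /to_bmultilin/= insubdK// inE. Qed.

Lemma frechetD0E x h : frechetD f 0 x h = f x.
Proof.
rewrite /= to_bmultilinE//; split; first by case.
by exists `|f x| => g; rewrite big_ord0 mulr1.
Qed.

Lemma frechetDSE n x (h : 'I_n.+1 -> X) : differentiable (frechetD f n) x ->
  frechetD f n.+1 x h = 'd (frechetD f n) x (h ord0) (fun i => h (lift ord0 i)).
Proof.
move=> df; rewrite /= to_bmultilinE//; set L := 'd _ _.
have dfw0 (g : 'I_n.+1 -> X) (u : X) :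
    (fun i => dfwith g ord0 u (lift ord0 i)) = (fun i => g (lift ord0 i)).
  by apply/funext => i; rewrite dfwithout ?neq_lift.
have dfwS (g : 'I_n.+1 -> X) j (u : X) :
    (fun i => dfwith g (lift ord0 j) u (lift ord0 i)) =
    dfwith (fun i => g (lift ord0 i)) j u.
  apply/funext => i; have [<-|ji] := eqVneq j i; first by rewrite !dfwithin.
  by rewrite !dfwithout// (inj_eq lift_inj).
split.
  move=> i g a u v; have [j ->|->] := unliftP ord0 i.
    rewrite !dfwS !dfwithout; last 3 first.
    - by rewrite eq_sym neq_lift.
    - by rewrite eq_sym neq_lift.
    - by rewrite eq_sym neq_lift.
    by have := bmultilin_funP (L (g ord0)); rewrite inE => -[+ _]; exact.
  by rewrite !dfw0 !dfwithin linearP.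
have [C hC] : exists C : R, forall u, `|L u| <= C * `|u|.
  have c0 : {for 0, continuous L} by exact: (diff_continuous df).
  have [C [_ hC]] := (linear_boundedP L).1 (continuous_linear_bounded 0 c0).
  by exists (C + 1) => u; apply: hC; rewrite ltrDl.
exists C => g; rewrite big_ord_recl mulrA.
apply: (le_trans (bmultilin_normP _ _)).
by rewrite ler_wpM2r ?prodr_ge0//; exact: hC.
Qed.

End FrechetFacts.

Definition Npos := {n : nat | (0 < n)%N}.

Section MixedPartials.
Context {R : realType} {Z : normedModType R}.
Implicit Types (F : {ptws Npos -> R} -> Z) (y : {ptws Npos -> R}) (n : Npos).

(** Here {ptws Npos -> R} is R^{N*} with the product topology, and
    [dfwith y n t] is y with the coordinate y_n replaced by t. *)
Definition has_partial F n y :=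
  derivable (fun t : R => F (dfwith y n t)) (y n) 1.

Definition partial n F y : Z := derive1 (fun t : R => F (dfwith y n t)) (y n).

(** [partials [:: n_1; ...; n_k] F] is d_{n_1} (... (d_{n_k} F)). *)
Definition partials (w : seq Npos) F : {ptws Npos -> R} -> Z :=
  foldr partial F w.

(** Existence of the mixed partial derivatives of all orders on N: the iterated
    partial derivatives exist in every order of differentiation and do not
    depend on it, so that d^alpha only depends on the multi-index alpha. *)
Definition has_mixed_partials (N : set {ptws Npos -> R}) F :=
  (forall (w : seq Npos) n y, N y -> has_partial (partials w F) n y) /\
  (forall (w w' : seq Npos) y, N y -> perm_eq w w' ->
     partials w F y = partials w' F y).

End MixedPartials.

Definition multiindex := {fsfun Npos -> nat with 0%N}.

Definition mi_norm (alpha : multiindex) : nat :=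
  (\sum_(n <- finsupp alpha) alpha n)%N.

Definition mi_pow {R : realType} (gamma : Npos -> R) (alpha : multiindex) : R :=
  \prod_(n <- finsupp alpha) gamma n ^+ alpha n.

(** d^alpha, taken in the order in which [finsupp alpha] is listed. *)
Definition mixed_partial {R : realType} {Z : normedModType R}
    (alpha : multiindex) (F : {ptws Npos -> R} -> Z) : {ptws Npos -> R} -> Z :=
  partials (flatten [seq nseq (alpha n) n | n <- finsupp alpha]) F.

Definition gevrey_mixed_on {R : realType} {Z : normedModType R} (s : R)
    (gamma : Npos -> R) (N : set {ptws Npos -> R}) (mu nu : R)
    (F : {ptws Npos -> R} -> Z) :=
  has_mixed_partials N F /\
  forall alpha : multiindex, alpha != [fsfun] ->
    (ereal_sup [set (`|mixed_partial alpha F y|)%:E | y in N] <=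
     (((mi_norm alpha)`!%:R `^ s) * mu * nu ^+ mi_norm alpha
       * mi_pow gamma alpha)%:E)%E.

(** F is a total function standing for a map defined on the open set D; all the
    conditions below are local at points of an open subset of D. *)
Definition gevrey_mixed_at {R : realType} {Z : normedModType R} (s : R)
    (gamma : Npos -> R) (D : set {ptws Npos -> R}) (y0 : {ptws Npos -> R})
    (F : {ptws Npos -> R} -> Z) :=
  exists N : set {ptws Npos -> R}, [/\ open N, N y0, N `<=` D &
    exists mu nu : R, [/\ 0 <= mu, 0 <= nu & gevrey_mixed_on s gamma N mu nu F]].

Definition gevrey_on {R : realType} {X Y : normedModType R} (s : R)
    (N : set X) (mu nu : R) (f : X -> Y) :=
  smooth_on N f /\
  forall n : nat, (0 < n)%N ->
    (ereal_sup [set (`|frechetD f n x|)%:E | x in N] <=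
     ((n`!%:R `^ s) * mu * nu ^+ n)%:E)%E.

(* Main.v *)
(** By induction on the order of differentiation along coordinate lines, every
    mixed partial derivative of M o P is the Faa di Bruno sum over the set
    partitions p = {b_1, ..., b_k} of the positions of the word w of
    differentiations, with terms D^k M(P y)(d^(b_1) P(y), ..., d^(b_k) P(y)).
    Only points of coordinate lines near y are involved, and these stay in N
    since P is differentiable, hence continuous, along each line; so N need not be
    open.  The derivatives may be reordered because P has this property and D^2 of
    each D^k M is symmetric.
    In the bound, the powers s - 1 of the factorials are absorbed by
    k! |b_1|! ... |b_k|! <= n!, and what remains is the exact identity
    sum_p k! |b_1|! ... |b_k|! a^k = n! a (1 + a)^(n - 1) for a = nuM muP. *)

Require Import Defs.
From HB Require Import structures.
From mathcomp Require Import all_boot all_order all_algebra finmap.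
From mathcomp Require Import all_classical all_reals all_analysis.
From mathcomp Require Import ring lra zify.

Set Implicit Arguments.
Unset Strict Implicit.
Unset Printing Implicit Defensive.

Import Order.TTheory GRing.Theory Num.Theory.
Import numFieldNormedType.Exports.

Local Open Scope classical_set_scope.
Local Open Scope ring_scope.

(** * Product and chain rules along a real parameter *)

Section ProductAndChainRules.
Context {R : realType} {U V W : normedModType R}.

Lemma bounded_bilinear_continuous (f : {bilinear U -> V -> W}) (C : R) :
  (forall u v, `|f u v| <= C * `|u| * `|v|) ->
  continuous (fun p : U * V => f p.1 p.2).
Proof.
move=> fC p; apply/subr_cvg0/norm_cvg0P.
(* [h] dominates the splitting f(q1 - p1, q2) + f(p1, q2 - p2) of the increment and vanishes at
   [p]. *)
pose h (q : U * V) : R := C * `|q.1 - p.1| * `|q.2| + C * `|p.1| * `|q.2 - p.2|.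
have h0 : h q @[q --> p] --> (0 : R).
  have -> : 0 = h p by rewrite /h !subrr !normr0 !(mulr0, mul0r) addr0.
  have c1 : q.1 @[q --> p] --> p.1 by exact: cvg_fst.
  have c2 : q.2 @[q --> p] --> p.2 by exact: cvg_snd.
  apply: cvgD; apply: cvgM.
  - apply: cvgM; first exact: cvg_cst.
    apply: cvg_norm; apply: cvgB => //; exact: cvg_cst.
  - exact: cvg_norm.
  - exact: cvg_cst.
  - apply: cvg_norm; apply: cvgB => //; exact: cvg_cst.
apply: (squeeze_cvgr _ (cvg_cst (0 : R)) h0).
apply: nearW => q; rewrite normr_ge0/=.
have -> : f q.1 q.2 - f p.1 p.2 = f (q.1 - p.1) q.2 + f p.1 (q.2 - p.2).
  by rewrite linearBl linearBr addrA subrK.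
by apply: (le_trans (ler_normD _ _)); exact: lerD.
Qed.

Lemma is_derive_bilinear (f : {bilinear U -> V -> W}) (g : R -> U) (h : R -> V)
    (t : R) (dg : U) (dh : V) : continuous (fun p : U * V => f p.1 p.2) ->
  is_derive t 1 g dg -> is_derive t 1 h dh ->
  is_derive t 1 (fun x => f (g x) (h x)) (f (g t) dh + f dg (h t)).
Proof.
move=> fc [g1 <-] [h1 <-].
have dg' := (derivable1_diffP _ _).1 g1; have dh' := (derivable1_diffP _ _).1 h1.
have dp : differentiable (fun x => (g x, h x)) t by exact: differentiable_pair.
have dB := differentiable_bilin (g t, h t) fc.
have dc : differentiable (fun x => f (g x) (h x)) t.
  exact: (differentiable_comp dp dB).
apply: DeriveDef; first exact/derivable1_diffP.
rewrite deriveE// (diff_comp dp dB)/= diff_bilin//= diff_pair//=.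
by rewrite !deriveE.
Qed.

End ProductAndChainRules.

Lemma is_derive_comp {R : realType} {V W : normedModType R} (F : V -> W)
    (g : R -> V) (t : R) (dg : V) : differentiable F (g t) ->
  is_derive t 1 g dg -> is_derive t 1 (F \o g) ('d F (g t) dg).
Proof.
move=> dF [g1 <-]; have dg' := (derivable1_diffP _ _).1 g1.
have dc := differentiable_comp dg' dF.
apply: DeriveDef; first exact/derivable1_diffP.
by rewrite deriveE// (diff_comp dg' dF)/= deriveE.
Qed.

(** * Mean value inequality for maps into normed spaces *)

Section MeanValueInequality.
Context {R : realType} {V : normedModType R}.

Lemma derive_locally_lipschitz (f : R -> V) (df : V) (c K : R) :
  is_derive c 1 f df -> `|df| < K ->
  exists2 d, 0 < d & forall t, `|t - c| < d -> `|f t - f c| <= K * `|t - c|.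
Proof.
move=> [f1 <-] dK.
have : \forall h \near 0^', `|h^-1 *: ((f \o shift c) (h *: 1) - f c)| < K.
  exact: cvgr_norm_lt dK.
move=> /nbhs_ballP [d /= d0 H]; exists d => // t td.
have [->|tc] := eqVneq t c; first by rewrite !subrr !normr0 mulr0.
have tc0 : t - c != 0 by rewrite subr_eq0.
have := H (t - c); rewrite -ball_normE /= sub0r normrN => /(_ td tc0).
rewrite [_%:A]mulr1 subrK normrZ normfV => /ltW.
by rewrite ler_pdivrMl ?normr_gt0// mulrC.
Qed.

(** In a normed space there need not be a point with the mean slope, so the bound is propagated from
    [a] by a supremum argument. The slack [e] makes the slope [K] strictly larger than every norm of
    a derivative, as the local Lipschitz estimate demands. *)
Lemma mean_value_inequality (f df : R -> V) (a b C : R) : a <= b ->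
  (forall t, a <= t <= b -> is_derive t 1 f (df t)) ->
  (forall t, a <= t <= b -> `|df t| <= C) ->
  `|f b - f a| <= C * (b - a).
Proof.
move=> ab fd dC; apply/ler_addgt0Pr => e e0.
have [->|aNb] := eqVneq a b; first by rewrite !subrr normr0 mulr0 add0r ltW.
have ba0 : 0 < b - a by rewrite subr_gt0 lt_neqAle aNb.
pose K := C + e / (b - a).
have CK : C < K by rewrite ltrDl divr_gt0.
have -> : C * (b - a) + e = K * (b - a) by rewrite mulrDl divfK ?gt_eqF.
have loc t : a <= t <= b -> exists2 d, 0 < d &
    forall x, `|x - t| < d -> `|f x - f t| <= K * `|x - t|.
  move=> tab; apply: derive_locally_lipschitz (fd t tab) _.
  exact: le_lt_trans (dC t tab) CK.
pose S := [set t | a <= t <= b /\ `|f t - f a| <= K * (t - a)].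
have Sa : S a by rewrite /S /= lexx ab !subrr normr0 mulr0.
have Sb : has_sup S by split; [exists a | exists b => t [/andP[]]].
pose c := sup S.
have ac : a <= c by apply: ub_le_sup => //; exact: Sb.2.
have cb : c <= b by apply: ge_sup; [exact: Sb.1|move=> t [/andP[]]].
have [|d d0 cd] := loc c; first by rewrite ac cb.
(* The supremum belongs to [S]: a point of [S] within [d] to its left is joined to it by the local
   estimate at [c]. *)
have Sc : S c.
  split; first by rewrite ac cb.
  have [t St ct] := sup_adherent d0 Sb.
  have tc : t <= c by apply: ub_le_sup => //; exact: Sb.2.
  have -> : f c - f a = (f t - f a) - (f t - f c) by rewrite opprB [RHS]addrC subrKA.
  have -> : K * (c - a) = K * (t - a) + K * (c - t) by ring.
  apply: (le_trans (ler_normB _ _)); apply: lerD; first exact: St.2.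
  rewrite -[c - t]ger0_norm ?subr_ge0// (distrC c t); apply: cd.
  by rewrite distrC ger0_norm ?subr_ge0// ltrBlDr -ltrBlDl.
have [<-|cNb] := eqVneq c b; first exact: Sc.2.
have {cNb} cb' : c < b by rewrite lt_neqAle cNb.
(* If [c < b], the same local estimate extends the bound past the supremum, a contradiction. *)
pose t := Num.min b (c + d / 2).
have ct : c < t by rewrite lt_min cb' ltrDl divr_gt0.
have tb : t <= b by rewrite ge_min lexx.
have St : S t.
  split; first by rewrite tb (le_trans ac)// ltW.
  have -> : f t - f a = (f t - f c) + (f c - f a) by rewrite subrKA.
  have -> : K * (t - a) = K * (t - c) + K * (c - a) by ring.
  apply: (le_trans (ler_normD _ _)); apply: lerD; last exact: Sc.2.
  have tc0 : `|t - c| = t - c by rewrite ger0_norm// subr_ge0 ltW.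
  rewrite -tc0; apply: cd; rewrite tc0 ltrBlDl gt_min; apply/orP; right.
  by rewrite ltrD2l ltr_pdivrMr// ltr_pMr// ltr1n.
have : t <= c by apply: ub_le_sup => //; exact: Sb.2.
by rewrite leNgt ct.
Qed.

End MeanValueInequality.

(** * Symmetry of the second derivative *)

Lemma is_derive_line {R : realType} {V : normedModType R} (x u : V) (t : R) :
  is_derive t 1 (fun s : R => s *: u + x) u.
Proof.
have /derivable1_diffP sD := @ex_diff _ _ _ _ _ _ _ (is_diff_scalel t u).
have sE : is_derive t 1 ( *:%R ^~ u) u.
  apply: DeriveDef => //; rewrite deriveE; last exact/derivable1_diffP.
  by rewrite diff_val scale1r.
by have := is_deriveD sE (is_derive_cst x t (1 : R)); rewrite addr0.
Qed.

Section SymmetricSecondDerivative.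
Context {R : realType} {V W : normedModType R}.

(** Two applications of the mean value inequality, first in [t] to [phis], then in [s] to the
    difference of [phi] between [t = d] and [t = 0], each after subtracting the linear part that [L]
    prescribes. *)
Lemma double_difference_bound (phi phis phist : R -> R -> W) (L : W) (e d : R) :
  0 <= d ->
  (forall s t, 0 <= s <= d -> 0 <= t <= d ->
    [/\ is_derive s 1 (phi ^~ t) (phis s t), is_derive t 1 (phis s) (phist s t)
      & `|phist s t - L| <= e]) ->
  `|phi d d - phi d 0 - (phi 0 d - phi 0 0) - (d * d) *: L| <= e * (d * d).
Proof.
move=> d0 H.
have dd : 0 <= d <= d by rewrite d0 lexx.
have z : 0 <= (0 : R) <= d by rewrite lexx d0.
have inner s : 0 <= s <= d -> `|phis s d - phis s 0 - d *: L| <= e * d.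
  (* The summand 0 matches the affine line of [is_derive_line]. *)
  move=> sd; pose f t := phis s t - (t *: L + 0).
  have -> : phis s d - phis s 0 - d *: L = f d - f 0.
    by rewrite /f !addr0 scale0r subr0 addrAC.
  rewrite -{2}[d]subr0.
  apply: (@mean_value_inequality _ _ _ (fun t => phist s t - L)) => // t td.
    have [_ dt _] := H s t sd td.
    have D := is_deriveB dt (is_derive_line 0 L t).
    exact: D.
  by have [] := H s t sd td.
pose f s := phi s d - phi s 0 - (s *: (d *: L) + 0).
have -> : phi d d - phi d 0 - (phi 0 d - phi 0 0) - (d * d) *: L = f d - f 0.
  by rewrite /f !addr0 scale0r subr0 scalerA addrAC.
rewrite mulrA -{3}[d]subr0.
apply: (@mean_value_inequality _ _ _ (fun s => phis s d - phis s 0 - d *: L)) => // s sd.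
  have [d1 _ _] := H s d sd dd; have [d2 _ _] := H s 0 sd z.
  have D := is_deriveB (is_deriveB d1 d2) (is_derive_line 0 (d *: L) s).
  exact: D.
Qed.

(* Schwarz: both mixed derivatives are limits of the same second difference
   quotient over the parallelogram spanned by [d *: u] and [d *: v]. *)
Lemma second_diff_sym (F Fu Fv : V -> W) (x u v : V) :
  (\forall y \near x, [/\ differentiable F y, 'd F y u = Fu y & 'd F y v = Fv y]) ->
  (\forall y \near x, differentiable Fu y /\ differentiable Fv y) ->
  {for x, continuous (fun y => 'd Fu y v)} ->
  {for x, continuous (fun y => 'd Fv y u)} ->
  'd Fu x v = 'd Fv x u.
Proof.
move=> nF nFuv cu cv; apply/eqP; rewrite -subr_eq0 -normr_le0.
apply/ler_addgt0Pr => e e0; rewrite add0r.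
have e20 : 0 < e / 2 by rewrite divr_gt0.
have {}cu : \forall y \near x, `|'d Fu x v - 'd Fu y v| <= e / 2.
  by have /cvgrPdist_le := cu; apply.
have {}cv : \forall y \near x, `|'d Fv x u - 'd Fv y u| <= e / 2.
  by have /cvgrPdist_le := cv; apply.
have [r r0 rP] : exists2 r, 0 < r & forall y, `|x - y| < r ->
    [/\ [/\ differentiable F y, 'd F y u = Fu y & 'd F y v = Fv y],
      differentiable Fu y /\ differentiable Fv y,
      `|'d Fu x v - 'd Fu y v| <= e / 2 & `|'d Fv x u - 'd Fv y u| <= e / 2].
  by apply/nbhs_normP; near=> y; split; near: y.
(* With [d2] equal to r / (2 c), the parallelogram stays within distance r of x, since s |u| + t |v|
   <= d2 c = r / 2. *)
pose c := `|u| + `|v| + 1.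
have c0 : 0 < c by rewrite ltr_wpDl// addr_ge0.
pose d := r / c; pose d2 := d / 2.
have d0 : 0 < d2 by rewrite !divr_gt0 ?ltr0n.
have near_x s t : 0 <= s <= d2 -> 0 <= t <= d2 -> `|x - (s *: u + (t *: v + x))| < r.
  move=> /andP[s0 sd] /andP[t0 td].
  rewrite addrA opprD addrCA subrr addr0 normrN.
  apply: (le_lt_trans (ler_normD _ _)); rewrite !normrZ !ger0_norm//.
  apply: (@le_lt_trans _ _ (d2 * c)).
    by rewrite /c !mulrDr mulr1 -[leLHS]addr0 !lerD// ?ler_wpM2r// ltW.
  by rewrite /d2 /d mulrAC divfK ?gt_eqF// ltr_pdivrMr// ltr_pMr// ltr1n.
have b1 := @double_difference_bound (fun s t => F (s *: u + (t *: v + x)))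
  (fun s t => Fu (s *: u + (t *: v + x))) (fun s t => 'd Fu (s *: u + (t *: v + x)) v)
  ('d Fu x v) (e / 2) d2 (ltW d0).
have b2 := @double_difference_bound (fun t s => F (s *: u + (t *: v + x)))
  (fun t s => Fv (s *: u + (t *: v + x))) (fun t s => 'd Fv (s *: u + (t *: v + x)) u)
  ('d Fv x u) (e / 2) d2 (ltW d0).
have swp (a b : R) : a *: u + (b *: v + x) = b *: v + (a *: u + x).
  by rewrite addrCA.
rewrite -(ler_pM2r (mulr_gt0 d0 d0)).
rewrite -{1}[d2 * d2](ger0_norm (ltW (mulr_gt0 d0 d0))).
rewrite mulrC -normrZ scalerBr.
set A := (F (d2 *: u + (d2 *: v + x)) - F (d2 *: u + (0 *: v + x)) -
  (F (0 *: u + (d2 *: v + x)) - F (0 *: u + (0 *: v + x)))).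
have A1 : `|A - (d2 * d2) *: 'd Fu x v| <= e / 2 * (d2 * d2).
  apply: b1 => s t sd td; have [[F1 Fu1 _] [Fu2 _] c1 _] := rP _ (near_x s t sd td).
  split; last by rewrite distrC.
    rewrite -Fu1; exact: is_derive_comp F1 (is_derive_line _ _ _).
  under eq_fun do rewrite swp.
  have := is_derive_comp _ (is_derive_line (s *: u + x) v t).
  rewrite -swp; exact.
have A2 : `|A - (d2 * d2) *: 'd Fv x u| <= e / 2 * (d2 * d2).
  (* Regrouping the four corners of [A] exchanges the roles of [u] and [v]. *)
  have -> : A = F (d2 *: u + (d2 *: v + x)) - F (0 *: u + (d2 *: v + x)) -
      (F (d2 *: u + (0 *: v + x)) - F (0 *: u + (0 *: v + x))).
    by rewrite /A !opprB addrACA [RHS]addrACA; congr (_ + _); rewrite addrC.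
  apply: b2 => t s td sd; have [[F1 _ Fv1] [_ Fv2] _ c2] := rP _ (near_x s t sd td).
  split; last by rewrite distrC.
    under eq_fun do rewrite swp.
    have := is_derive_comp _ (is_derive_line (s *: u + x) v t).
    rewrite -swp -Fv1; exact.
  exact: is_derive_comp Fv2 (is_derive_line _ _ _).
have -> : (d2 * d2) *: 'd Fu x v - (d2 * d2) *: 'd Fv x u =
    (A - (d2 * d2) *: 'd Fv x u) - (A - (d2 * d2) *: 'd Fu x v).
  by rewrite opprB [RHS]addrC subrKA.
rewrite [e]splitr mulrDl; apply: (le_trans (ler_normB _ _)); exact: lerD.
Unshelve. all: by end_near. Qed.

End SymmetricSecondDerivative.

(** * Currying of bounded multilinear maps *)

Section Currying.
Context {R : realType} {X Y : normedModType R}.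

Definition cons_arg n (u : X) (h : 'I_n -> X) : 'I_n.+1 -> X :=
  fun i => if unlift ord0 i is Some j then h j else u.

Lemma cons_arg0 n u (h : 'I_n -> X) : cons_arg u h ord0 = u.
Proof. by rewrite /cons_arg unlift_none. Qed.

Lemma cons_argS n u (h : 'I_n -> X) i : cons_arg u h (lift ord0 i) = h i.
Proof. by rewrite /cons_arg liftK. Qed.

Lemma cons_arg_dfwith0 n u v (h : 'I_n -> X) :
  cons_arg u h = dfwith (cons_arg v h) ord0 u.
Proof.
apply/funext => i; have [j ->|->] := unliftP ord0 i.
  by rewrite dfwithout ?neq_lift// !cons_argS.
by rewrite dfwithin cons_arg0.
Qed.

Lemma cons_arg_dfwithS n u (h : 'I_n -> X) i v :
  cons_arg u (dfwith h i v) = dfwith (cons_arg u h) (lift ord0 i) v.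
Proof.
apply/funext => j; have [k ->|->] := unliftP ord0 j.
  rewrite cons_argS; have [<-|ik] := eqVneq i k; first by rewrite !dfwithin.
  by rewrite !dfwithout ?cons_argS// (inj_eq lift_inj).
by rewrite dfwithout ?cons_arg0// eq_sym neq_lift.
Qed.

Lemma bmultilin_multilinear n (A : bmultilin n X Y) : multilinear A.
Proof. by have := bmultilin_funP A; rewrite inE => -[]. Qed.

Lemma bmultilin_ext n (A B : bmultilin n X Y) : (forall h, A h = B h) -> A = B.
Proof. by move=> AB; apply/val_inj/funext. Qed.

(** One direction of the identification of B^(n+1)(X; Y) with the bounded linear maps from X to
    B^n(X; Y). By [bmcurryE] the default value of [to_bmultilin] never occurs. *)
Definition bmcurry n (A : bmultilin n.+1 X Y) (u : X) : bmultilin n X Y :=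
  to_bmultilin (fun h => A (cons_arg u h)).

Lemma bmcurryE n (A : bmultilin n.+1 X Y) u h : bmcurry A u h = A (cons_arg u h).
Proof.
rewrite /bmcurry to_bmultilinE//; split.
  by move=> i g a v w; rewrite !cons_arg_dfwithS; exact: bmultilin_multilinear.
exists (`|A| * `|u|) => g; have := bmultilin_normP A (cons_arg u g).
rewrite big_ord_recl cons_arg0 mulrA; under eq_bigr do rewrite cons_argS.
by [].
Qed.

Lemma bmcurry_bilinear n :
  bilinear_for ( *:%R : R -> bmultilin n X Y -> bmultilin n X Y) *:%R (@bmcurry n).
Proof.
split=> [u|A].
  by move=> a A B; apply: bmultilin_ext => h; rewrite /= !fctE !bmcurryE.
move=> a u v; apply: bmultilin_ext => h; rewrite /= !fctE !bmcurryE.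
(* The head 0 is arbitrary: it presents the three argument lists as updates of one list at
   [ord0]. *)
rewrite (cons_arg_dfwith0 _ 0 h) (cons_arg_dfwith0 u 0 h) (cons_arg_dfwith0 v 0 h).
exact: bmultilin_multilinear.
Qed.

HB.instance Definition _ n := bilinear_isBilinear.Build R _ _ _ _ _
  (@bmcurry n) (@bmcurry_bilinear n).

Lemma bmcurry_norm n (A : bmultilin n.+1 X Y) u : `|bmcurry A u| <= `|A| * `|u|.
Proof.
apply: bmultilin_norm_le => h h1; rewrite bmcurryE.
apply: (le_trans (bmultilin_normP _ _)).
rewrite big_ord_recl cons_arg0 mulrA; under eq_bigr do rewrite cons_argS.
rewrite ler_piMr//; first by rewrite mulr_ge0// bmultilin_norm_ge0.
by apply: prodr_ile1 => i _; rewrite normr_ge0 h1.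
Qed.

Lemma bmcurry_continuous n :
  continuous (fun p : bmultilin n.+1 X Y * X => bmcurry p.1 p.2).
Proof.
apply: (@bounded_bilinear_continuous _ _ _ _ _ 1) => A u.
by rewrite mul1r bmcurry_norm.
Qed.

Lemma is_diff_bmcurryl n (u : X) (A : bmultilin n.+1 X Y) :
  is_diff A (fun B => bmcurry B u) (fun B => bmcurry B u).
Proof.
have curL : linear (fun B : bmultilin n.+1 X Y => bmcurry B u).
  by move=> a B C; rewrite linearPl.
pose curM := GRing.isLinear.Build _ _ _ _ _ curL.
pose cur : {linear bmultilin n.+1 X Y -> bmultilin n X Y} :=
  HB.pack (fun B : bmultilin n.+1 X Y => bmcurry B u) curM.
have curc : continuous cur.
  apply: bounded_linear_continuous; apply/linear_boundedP.
  exists `|u|; split; first exact: num_real.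
  move=> r /ltW ur B; apply: (le_trans (bmcurry_norm _ _)).
  by rewrite mulrC ler_wpM2r// bmultilin_norm_ge0.
apply: DiffDef; first exact: (linear_differentiable A curc).
by rewrite (diff_lin A curc).
Qed.

(** The recursion D^(n+1) = D(D^n) in the form in which the chain rule produces it, with only the
    direction [u] applied. *)
Lemma curry_frechetD (f : X -> Y) n x u : differentiable (frechetD f n) x ->
  bmcurry (frechetD f n.+1 x) u = 'd (frechetD f n) x u.
Proof.
move=> df; apply: bmultilin_ext => h; rewrite bmcurryE frechetDSE// cons_arg0.
by congr bmultilin_fun; apply/funext => i; rewrite cons_argS.
Qed.

Lemma is_derive_eval n (A : R -> bmultilin n X Y) dA (t : R) (h : 'I_n -> X) :
  is_derive t 1 A dA -> is_derive t 1 (fun x => A x h) (dA h).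
Proof.
move=> AD; have evL : linear (fun B : bmultilin n X Y => B h).
  by move=> a B C; rewrite /= !fctE.
pose evM := GRing.isLinear.Build _ _ _ _ _ evL.
pose ev : {linear bmultilin n X Y -> Y} := HB.pack (fun B : bmultilin n X Y => B h) evM.
have evc : continuous ev.
  apply: bounded_linear_continuous; apply/linear_boundedP.
  exists (\prod_(i < n) `|h i|); split; first exact: num_real.
  move=> r /ltW hr B; apply: (le_trans (bmultilin_normP _ _)).
  by rewrite mulrC ler_wpM2r ?bmultilin_norm_ge0.
have := is_derive_comp (linear_differentiable (A t) evc) AD.
by rewrite diff_lin.
Qed.

End Currying.

(** * Leibniz rule for multilinear forms applied along a list *)

Section ApplyAlongList.
Context {R : realType} {X Y : normedModType R} {T : Type}.
Implicit Types (g : T -> X) (s : seq T) (A : forall k, bmultilin k X Y).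

(* [mapply g s A] is A_k (g s_0, ..., g s_(k-1)) with k = size s: a whole family
   of forms is carried along so that no type depends on the length of s. *)
Fixpoint mapply g s A : Y :=
  if s is b :: s' then mapply g s' (fun k => bmcurry (A k.+1) (g b))
  else A 0%N (fun=> 0).

Lemma eq_mapply g s A B : (forall k, A k = B k) -> mapply g s A = mapply g s B.
Proof.
elim: s A B => /= [|b s IH] A B AB; first by rewrite AB.
by apply: IH => k; rewrite AB.
Qed.

Lemma mapplyD g s A B :
  mapply g s (fun k => A k + B k) = mapply g s A + mapply g s B.
Proof.
elim: s A B => /= [|b s IH] A B; first by rewrite fctE.
by rewrite -IH; apply: eq_mapply => k; rewrite linearDl.
Qed.

Lemma mapply_norm g s A : `|mapply g s A| <= `|A (size s)| * \prod_(b <- s) `|g b|.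
Proof.
elim: s A => /= [|b s IH] A.
  have := bmultilin_normP (A 0%N) (fun=> 0); by rewrite big_ord0 big_nil.
rewrite big_cons mulrA; apply: (le_trans (IH _)).
by rewrite ler_wpM2r ?bmcurry_norm// prodr_ge0.
Qed.

(** The index set of the Leibniz rule. *)
Fixpoint act_one (D : T -> T) s : seq (seq T) :=
  if s is b :: s' then (D b :: s') :: [seq b :: s'' | s'' <- act_one D s']
  else [::].

(** Labels stand for functions and [D] sends a label to that of the derivative, so every term is
    again a [mapply]. Each currying is one bilinear product, which gives the induction on [s]. *)
Lemma is_derive_mapply (g : R -> T -> X) (D : T -> T) s
    (A : R -> forall k, bmultilin k X Y) dA (t : R) :
  (forall k, is_derive t 1 (A ^~ k) (dA k)) ->
  (forall b, is_derive t 1 (g ^~ b) (g t (D b))) ->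
  is_derive t 1 (fun x => mapply (g x) s (A x))
    (mapply (g t) s dA + \sum_(s' <- act_one D s) mapply (g t) s' (A t)).
Proof.
move=> + gD; elim: s A dA => /= [|b s IH] A dA AD.
  by rewrite big_nil addr0; exact: is_derive_eval.
have AD' k := is_derive_bilinear (@bmcurry_continuous _ _ _ k) (AD k.+1) (gD b).
apply: is_derive_eq (IH _ _ AD') _.
by rewrite mapplyD big_cons big_map addrA; congr (_ + _); rewrite addrC.
Qed.

End ApplyAlongList.

(** * Set partitions of words and their weights *)

Section OrderedPartitions.
Context {T : eqType}.
Implicit Types (a b : T) (w : seq T) (p q : seq (seq T)).

(** The two effects of one more differentiation on a term: on the outer derivative it opens a block,
    on an argument it enlarges one. *)
Definition add_letter a p := ([:: a] :: p) :: act_one (cons a) p.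

(* Lists, block by block, the set partitions of the positions of a word: these
   index the terms of the iterated chain rule (Faa di Bruno). *)
Fixpoint word_partitions w : seq (seq (seq T)) :=
  if w is a :: w' then flatten [seq add_letter a p | p <- word_partitions w']
  else [:: [::]].

Lemma word_partitions_sum (V : zmodType) (f : seq (seq T) -> V) a w :
  \sum_(p <- word_partitions (a :: w)) f p =
  \sum_(p <- word_partitions w) \sum_(q <- add_letter a p) f q.
Proof. by rewrite /= big_flatten big_map. Qed.

Lemma act_one_size a p q : q \in act_one (cons a) p -> size q = size p.
Proof.
elim: p q => [//|b p IH] q /=; rewrite inE => /orP[/eqP->//|/mapP[q' q'p ->]] /=.
by rewrite (IH _ q'p).
Qed.

Lemma act_one_flatten a p q :
  q \in act_one (cons a) p -> perm_eq (flatten q) (a :: flatten p).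
Proof.
elim: p q => [//|b p IH] q /=; rewrite inE => /orP[/eqP->//|/mapP[q' q'p ->]] /=.
have := IH _ q'p; rewrite -(perm_cat2l b) => /perm_trans; apply.
by rewrite -cat1s perm_catCA.
Qed.

Lemma act_one_nil a p q : q \in act_one (cons a) p -> [::] \notin p -> [::] \notin q.
Proof.
elim: p q => [//|b p IH] q /=; rewrite inE.
move=> /orP[/eqP->|/mapP[q' q'p ->]]; rewrite !inE !negb_or => /andP[b0 p0].
  by rewrite p0.
by rewrite b0 (IH _ q'p).
Qed.

Lemma word_partitions_flatten w p : p \in word_partitions w -> perm_eq (flatten p) w.
Proof.
elim: w p => [p|a w IH p]; first by rewrite inE => /eqP->.
move=> /flattenP[_ /mapP[q qw ->]]; rewrite inE => /orP[/eqP->|pq].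
  by rewrite /= perm_cons IH.
by apply: (perm_trans (act_one_flatten pq)); rewrite perm_cons IH.
Qed.

Lemma word_partitions_nil w p : p \in word_partitions w -> [::] \notin p.
Proof.
elim: w p => [p|a w IH p]; first by rewrite inE => /eqP->.
move=> /flattenP[_ /mapP[q qw ->]]; rewrite inE => /orP[/eqP->|pq].
  by rewrite inE (IH _ qw).
exact: act_one_nil pq (IH _ qw).
Qed.

Lemma word_partitions_size_gt0 w p :
  (0 < size w)%N -> p \in word_partitions w -> (0 < size p)%N.
Proof.
move=> w0 /word_partitions_flatten/perm_size pw.
by case: p pw w0 => //= <-.
Qed.

Lemma size_le_flatten p : [::] \notin p -> (size p <= size (flatten p))%N.
Proof.
elim: p => [//|b p IH]; rewrite inE negb_or => /andP[b0 /IH pp] /=.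
rewrite size_cat -add1n leq_add// lt0n size_eq0 eq_sym; exact: b0.
Qed.

Definition block_fact p := (\prod_(b <- p) (size b)`!)%N.

Definition partition_weight p := ((size p)`! * block_fact p)%N.

(** Enlarging a block b multiplies the product by |b| + 1, and |b| is at most the total length. *)
Lemma block_fact_act_one a p q : q \in act_one (cons a) p ->
  (block_fact q <= (size (flatten p)).+1 * block_fact p)%N.
Proof.
rewrite /block_fact; elim: p q => [//|b p IH] q /=; rewrite inE size_cat.
move=> /orP[/eqP->|/mapP[q' q'p ->]]; rewrite !big_cons/=.
  by rewrite factS -mulnA leq_mul2r ltnS leq_addr orbT.
rewrite mulnCA leq_mul2l; apply/orP; right; apply: (leq_trans (IH _ q'p)).
by rewrite leq_mul2r ltnS leq_addl orbT.
Qed.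

(** A new letter multiplies the weight by k + 1 if it opens a block and by |b| + 1 if it joins b.
    Both factors are at most |w| + 1, the former because blocks are nonempty, whence k <= |w|. *)
Lemma word_partitions_weight w p :
  p \in word_partitions w -> (partition_weight p <= (size w)`!)%N.
Proof.
rewrite /partition_weight; elim: w p => [p|a w IH p].
  by rewrite inE => /eqP->; rewrite /block_fact big_nil.
move=> /flattenP[_ /mapP[q qw ->]] pq; rewrite /= factS.
have qs : size (flatten q) = size w by apply/perm_size/word_partitions_flatten.
have {}IH := IH _ qw; apply: leq_trans (leq_mul (leqnn _) IH).
move: pq; rewrite inE => /orP[/eqP->|pq].
  rewrite /block_fact big_cons/= mul1n factS -mulnA leq_mul2r ltnS.
  by rewrite -qs size_le_flatten ?orbT// (word_partitions_nil qw).
by rewrite (act_one_size pq) mulnCA leq_mul2l -qs (block_fact_act_one pq) orbT.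
Qed.

(** The factors |b| + 1 add up, over k blocks with n letters in all, to n + k. *)
Lemma block_fact_act_one_sum a p :
  (\sum_(q <- act_one (cons a) p) block_fact q =
   (size (flatten p) + size p) * block_fact p)%N.
Proof.
rewrite /block_fact; elim: p => [|b p IH] /=; first by rewrite big_nil.
rewrite big_cons big_map !big_cons size_cat/= factS.
under [X in (_ + X)%N]eq_bigr do rewrite big_cons.
by rewrite -big_distrr/= IH; nia.
Qed.

(** Stated for polynomials and evaluated afterwards, because the recursion on the word
    differentiates in the variable that marks blocks. *)
Lemma word_partitions_poly (R : comNzRingType) w : (0 < size w)%N ->
  \sum_(p <- word_partitions w) 'X^(size p) *+ partition_weight p =
  ('X * (1 + 'X) ^+ (size w).-1) *+ (size w)`! :> {poly R}.
Proof.
pose G v : {poly R} := \sum_(p <- word_partitions v) 'X^(size p) *+ partition_weight p.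
rewrite -/(G w).
(* Adding a letter acts on the generating polynomial in the number of blocks as
   a first-order differential operator. *)
have GS a v : G (a :: v) = ((size v)%:R + 'X) * G v + 'X * (1 + 'X) * (G v)^`().
  rewrite /G word_partitions_sum raddf_sum/= !mulr_sumr -big_split/=.
  apply: eq_big_seq => p pv; rewrite big_cons.
  have ps : size (flatten p) = size v by apply/perm_size/word_partitions_flatten.
  rewrite (eq_big_seq (fun q => 'X^(size p) *+ ((size p)`! * block_fact q))); last first.
    by move=> q /act_one_size; rewrite /partition_weight => ->.
  rewrite -(big_morph _ (mulrnDr _) (mulr0n _)) -big_distrr/= block_fact_act_one_sum ps.
  rewrite /partition_weight {1}/block_fact big_cons/= mul1n -/(block_fact p).
  rewrite derivMn derivXn; case: (size p) => [|k].
    rewrite (_ : 1`! = 1%N)// fact0 !mul1n addn0 mulr0n mul0rn expr0 expr1.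
    by ring.
  rewrite !exprS/= (factS k.+1); ring.
(* The induction starts at one letter: for the empty word the left side is 1 and the right side
   ['X]. *)
case: w => [//|a w] _; elim: w a => [|b w IH] a.
  rewrite GS /G/= !big_seq1/= /partition_weight /block_fact big_nil/=.
  by rewrite muln1 (_ : 0`! = 1%N)// (_ : 1`! = 1%N)// !mulr1n expr0 derivC; ring.
rewrite GS IH/= derivMn derivM derivX deriv_exp derivD derivC derivX (factS (size w).+1).
case: (size w) => [|m]/=.
  by rewrite (_ : 1`! = 1%N)// muln1 !mulr0n !mulr1n expr1 expr0; ring.
by rewrite !exprS; move: ((1 + 'X) ^+ m) (_`!) => q c; ring.
Qed.

End OrderedPartitions.

(** * Summation of the Gevrey bounds over partitions *)

Section GevreySum.
Context {R : realType} {T : eqType}.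
Implicit Types (w : seq T) (p : seq (seq T)) (gamma : T -> R).

Lemma word_partitions_sum_pow (a : R) w : (0 < size w)%N ->
  \sum_(p <- word_partitions w) (partition_weight p)%:R * a ^+ size p =
  (size w)`!%:R * (a * (1 + a) ^+ (size w).-1).
Proof.
move=> w0; have /(congr1 (fun q : {poly R} => q.[a])) := word_partitions_poly R w0.
rewrite horner_sum hornerMn hornerM horner_exp hornerD hornerX hornerC => H.
rewrite [RHS]mulr_natl -H.
by apply: eq_bigr => p _; rewrite hornerMn hornerXn mulr_natl.
Qed.

Lemma prod_block_bounds gamma (s mu nu : R) p :
  \prod_(b <- p) ((size b)`!%:R `^ s * mu * nu ^+ size b * \prod_(i <- b) gamma i) =
  (block_fact p)%:R `^ s * mu ^+ size p * nu ^+ size (flatten p)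
    * \prod_(i <- flatten p) gamma i.
Proof.
rewrite /block_fact; elim: p => [|b p IH].
  by rewrite !big_nil/= !expr0 powR1 !mulr1.
rewrite /= !big_cons IH size_cat big_cat/= natrM powRM// exprS exprD.
by ring.
Qed.

(** Terms are compared one by one: exponents rise to [s] since factorials are at least 1, and W^s <=
    n!^(s-1) W for a weight W <= n!; then the exact partition sum applies. The last hypothesis fixes
    the sign of the product as a whole, since [nuP] and the single [gamma i] may be negative. *)
Lemma gevrey_partition_sum gamma (sP sM s muP nuP muM nuM : R) w :
  sP <= s -> sM <= s -> 1 <= s -> 0 <= muP -> 0 <= muM -> 0 <= nuM ->
  (0 < size w)%N -> 0 <= muP * nuP ^+ size w * \prod_(i <- w) gamma i ->
  \sum_(p <- word_partitions w) ((size p)`!%:R `^ sM * muM * nuM ^+ size p *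
    \prod_(b <- p)
      ((size b)`!%:R `^ sP * muP * nuP ^+ size b * \prod_(i <- b) gamma i)) <=
  (size w)`!%:R `^ s * (muM * (nuM * muP / (nuM * muP + 1)))
    * ((nuM * muP + 1) * nuP) ^+ size w * \prod_(i <- w) gamma i.
Proof.
move=> sPs sMs s1 muP0 muM0 nuM0 w0; set G := \prod_(i <- w) gamma i => G0.
set a := nuM * muP; have a0 : 0 <= a by rewrite mulr_ge0.
have a1 : a + 1 != 0 by rewrite gt_eqF// ltr_wpDl.
have s0 : 0 < s by rewrite (lt_le_trans ltr01).
set n := size w.
have fact_ge1 m : 1 <= (m`!)%:R :> R by rewrite ler1n fact_gt0.
have -> : (n`!)%:R `^ s * (muM * (a / (a + 1))) * ((a + 1) * nuP) ^+ n * G =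
    \sum_(p <- word_partitions w) (n`!)%:R `^ (s - 1) * (partition_weight p)%:R
      * (muM * a ^+ size p * (nuP ^+ n * G)).
  transitivity ((n`!)%:R `^ (s - 1) * muM * (nuP ^+ n * G) *
      \sum_(p <- word_partitions w) (partition_weight p)%:R * a ^+ size p).
    rewrite (word_partitions_sum_pow _ w0) -/n -(mulr_powRB1 _ s0)//.
    have aS : (a + 1) ^+ n = (a + 1) * (a + 1) ^+ n.-1 by rewrite -exprS prednK.
    rewrite exprMn aS [1 + a]addrC.
    by field.
  by rewrite mulr_sumr; apply: eq_bigr => p _; ring.
rewrite !big_seq; apply: ler_sum => p pw.
have pfl := word_partitions_flatten pw.
rewrite prod_block_bounds (perm_size pfl) -/n (perm_big _ pfl)/= -/G.
have -> : (size p)`!%:R `^ sM * muM * nuM ^+ size p *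
    ((block_fact p)%:R `^ sP * muP ^+ size p * nuP ^+ n * G) =
    (size p)`!%:R `^ sM * (block_fact p)%:R `^ sP
      * (muM * a ^+ size p * (nuP ^+ n * G)) by rewrite exprMn; ring.
apply: ler_wpM2r.
  (* There is at least one block, so [a ^+ size p] supplies the factor [muP] that the sign
     hypothesis contains. *)
  have := word_partitions_size_gt0 w0 pw; case: (size p) => // k _.
  have -> : muM * a ^+ k.+1 * (nuP ^+ n * G) = muM * a ^+ k * nuM * (muP * nuP ^+ n * G).
    by rewrite exprS /a; ring.
  by apply: mulr_ge0 => //; rewrite !mulr_ge0 ?exprn_ge0.
have bf1 : 1 <= (block_fact p)%:R :> R.
  by rewrite ler1n prodn_gt0// => b; rewrite fact_gt0.
apply: (@le_trans _ _ ((partition_weight p)%:R `^ s)).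
  by rewrite natrM powRM// ler_pM ?powR_ge0 ?ler_powR.
rewrite -(mulr_powRB1 _ s0)// mulrC ler_wpM2r//.
by rewrite ge0_ler_powR ?subr_ge0 ?nnegrE// ler_nat word_partitions_weight.
Qed.

End GevreySum.

(** * Multi-indices as words *)

Section MultiIndexWords.

Definition mi_word (alpha : multiindex) : seq Npos :=
  flatten [seq nseq (alpha n) n | n <- finsupp alpha].

Lemma count_mi_word (alpha : multiindex) n : count_mem n (mi_word alpha) = alpha n.
Proof.
rewrite /mi_word count_flatten -map_comp sumnE big_map.
under eq_bigr do rewrite /= count_nseq.
have [na|na] := boolP (n \in finsupp alpha).
  rewrite (bigD1_seq n) ?fset_uniq//= eqxx mul1n big1 ?addn0// => m mn.
  by rewrite (negPf mn) mul0n.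
rewrite big_seq big1 ?fsfun_dflt// => m ma.
rewrite /=; have [mn|_] := eqVneq m n; last by rewrite mul0n.
by rewrite -mn ma in na.
Qed.

Lemma size_mi_word (alpha : multiindex) : size (mi_word alpha) = mi_norm alpha.
Proof.
rewrite /mi_word /mi_norm size_flatten /shape -map_comp sumnE big_map.
by apply: eq_bigr => n _; rewrite /= size_nseq.
Qed.

Lemma prod_mi_word (R : realType) (gamma : Npos -> R) (alpha : multiindex) :
  \prod_(n <- mi_word alpha) gamma n = mi_pow gamma alpha.
Proof.
rewrite /mi_word /mi_pow big_flatten big_map; apply: eq_bigr => n _.
by rewrite big_nseq iter_mulr_1.
Qed.

Lemma mi_word_gt0 (alpha : multiindex) : alpha != [fsfun] -> (0 < size (mi_word alpha))%N.
Proof.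
move=> /eqP a0; rewrite lt0n; apply/eqP => /size0nil w0; apply: a0.
by apply/fsfunP => n; rewrite -count_mi_word w0 fsfun0E.
Qed.

Definition mi_of_word (w : seq Npos) : multiindex :=
  [fsfun n in [fset m in w]%fset => count_mem n w].

Lemma perm_mi_of_word w : perm_eq w (mi_word (mi_of_word w)).
Proof.
apply/allP => n _ /=; rewrite count_mi_word /mi_of_word fsfunE in_fset/=.
by case: ifP => // /negbT/count_memPn->.
Qed.

Context {R : realType} {Z : normedModType R}.
Implicit Types (F : {ptws Npos -> R} -> Z) (N : set {ptws Npos -> R}).

(** Every word is a permutation of the canonical word of its own multi-index, and on [N] the order
    of differentiation does not matter. *)
Lemma gevrey_word_bound (s : R) gamma N mu nu F w y :
  gevrey_mixed_on s gamma N mu nu F -> N y -> (0 < size w)%N ->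
  `|partials w F y| <=
    (size w)`!%:R `^ s * mu * nu ^+ size w * \prod_(n <- w) gamma n.
Proof.
move=> [[_ Fsym] Fb] Ny w0; have pw := perm_mi_of_word w.
rewrite (perm_size pw) (perm_big _ pw)/= prod_mi_word size_mi_word (Fsym _ _ _ Ny pw).
have a0 : mi_of_word w != [fsfun].
  apply/eqP => a0; move: w0; rewrite (perm_size pw) a0 size_mi_word /mi_norm.
  by rewrite finsupp0 big_nil.
by have /ereal_supP/(_ (_%:E)) := Fb _ a0; rewrite -lee_fin; apply; exists y.
Qed.

Lemma gevrey_mixed_onS (s : R) gamma N N' mu nu F : N' `<=` N ->
  gevrey_mixed_on s gamma N mu nu F -> gevrey_mixed_on s gamma N' mu nu F.
Proof.
move=> N'N [[F1 F2] F3]; split; first split.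
- by move=> w n y /N'N; exact: F1.
- by move=> w w' y /N'N; exact: F2.
- move=> alpha /F3; apply: le_trans; apply: le_ereal_sup.
  exact: image_subset.
Qed.

End MultiIndexWords.

(** * Exchange of two successive letters *)

Section ActTwice.
Context {T : Type} {V : nmodType}.

(** If [D] and [E] hit different entries, both orders yield the same lists; they differ only where
    one entry is hit twice, which the hypothesis covers. *)
Lemma act_one_exchange (D E : T -> T) (s : seq T) (f : seq T -> V) :
  (forall s1 b s2, f (s1 ++ D (E b) :: s2) = f (s1 ++ E (D b) :: s2)) ->
  \sum_(s' <- act_one E s) \sum_(s'' <- act_one D s') f s'' =
  \sum_(s' <- act_one D s) \sum_(s'' <- act_one E s') f s''.
Proof.
elim: s f => [|b s IH] f fDE /=; first by rewrite !big_nil.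
have step (G H : T -> T) :
  \sum_(s' <- (H b :: s) :: [seq b :: s'' | s'' <- act_one H s])
    \sum_(s'' <- act_one G s') f s'' =
  f (G (H b) :: s) + (\sum_(s' <- act_one G s) f (H b :: s') +
    \sum_(s' <- act_one H s) f (G b :: s')) +
  \sum_(s' <- act_one H s) \sum_(s'' <- act_one G s') f (b :: s'').
  rewrite big_cons/= big_cons big_map -!addrA; congr (_ + (_ + _)).
  rewrite big_map -big_split/=; apply: eq_bigr => s' _.
  by rewrite big_cons big_map.
rewrite !step (IH (fun s' => f (b :: s'))) => [|s1 c s2]; last exact: (fDE (b :: s1)).
by rewrite (fDE [::]) [X in _ + X + _]addrC.
Qed.

End ActTwice.

(** The two orders differ only in the order of two new singletons and in the order of [a] and [b]
    inside a common block. The first hypothesis will come from the symmetry of second derivatives of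
    the outer map, the second from that of the partial derivatives of the inner one. *)
Lemma add_letter_exchange {T : eqType} {V : nmodType} (f : seq (seq T) -> V) a b p :
  f ([:: a] :: [:: b] :: p) = f ([:: b] :: [:: a] :: p) ->
  (forall s1 w s2, f (s1 ++ (a :: b :: w) :: s2) = f (s1 ++ (b :: a :: w) :: s2)) ->
  \sum_(q <- add_letter b p) \sum_(r <- add_letter a q) f r =
  \sum_(q <- add_letter a p) \sum_(r <- add_letter b q) f r.
Proof.
move=> f2 fab; have ex c d : \sum_(q <- add_letter c p) \sum_(r <- add_letter d q) f r =
    f ([:: d] :: [:: c] :: p) + f ([:: d; c] :: p) +
    (\sum_(q <- act_one (cons d) p) f ([:: c] :: q) +
     \sum_(q <- act_one (cons c) p) f ([:: d] :: q)) +
    \sum_(q <- act_one (cons c) p) \sum_(r <- act_one (cons d) q) f r.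
  rewrite [LHS]big_cons big_cons [act_one _ (_ :: _)]/= big_cons big_map -!addrA.
  congr (_ + (_ + (_ + _))); rewrite -big_split/=; apply: eq_bigr => q _.
  by rewrite big_cons.
rewrite (ex b a) (ex a b); congr (_ + _ + _ + _).
- exact: f2.
- exact: (fab [::]).
- by rewrite addrC.
- by apply: act_one_exchange => s1 w s2; exact: fab.
Qed.

Section MapplySymmetry.
Context {R : realType} {X Y : normedModType R} {T : Type}.

Lemma eq_mapply_arg (g : T -> X) s1 b c s2 (A : forall k, bmultilin k X Y) :
  g b = g c -> mapply g (s1 ++ b :: s2) A = mapply g (s1 ++ c :: s2) A.
Proof. by elim: s1 A => /= [|a s1 IH] A bc; [rewrite bc | exact: IH]. Qed.

End MapplySymmetry.

(** * Iterated chain rule and order of differentiation *)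

Section ChainRule.
Context {R : realType} {X Y : normedModType R}.
Variables (P : {ptws Npos -> R} -> X) (M : X -> Y).
Variables (NP : set {ptws Npos -> R}) (NM : set X).
Hypotheses (NP_open : open NP) (NM_open : open NM).
Hypotheses (P_partials : has_mixed_partials NP P) (M_smooth : smooth_on NM M).
Let N := NP `&` P @^-1` NM.
Let Q := M \o P.
Implicit Types (w : seq Npos) (y : {ptws Npos -> R}).

Lemma dfwith_id y n : dfwith y n (y n) = y.
Proof. by apply/funext => m; case: dfwithP. Qed.

Lemma is_derive_partials w n y : N y ->
  is_derive (y n) 1 (fun t => partials w P (dfwith y n t)) (partials (n :: w) P y).
Proof.
move=> [NPy _]; apply: DeriveDef; first exact: P_partials.1.
by rewrite /= /partial derive1E.
Qed.

Lemma near_dfwith y n : N y -> \forall t \near y n, N (dfwith y n t).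
Proof.
move=> Ny; have yE := dfwith_id y n.
have c1 : {for y n, continuous (fun t : R => dfwith y n t : {ptws Npos -> R})}.
  exact: dfwith_continuous.
have c2 : {for y n, continuous (fun t => P (dfwith y n t))}.
  apply: differentiable_continuous; apply/derivable1_diffP.
  exact: @ex_derive _ _ _ _ _ _ _ (is_derive_partials [::] n Ny).
near=> t; split; near: t.
  by apply: c1; rewrite yE; exact: open_nbhs_nbhs (conj NP_open Ny.1).
by apply: c2; rewrite yE; exact: open_nbhs_nbhs (conj NM_open Ny.2).
Unshelve. all: by end_near. Qed.

Definition chain_term p y : Y :=
  mapply (fun w => partials w P y) p (fun k => frechetD M k (P y)).

(** Differentiating D^k M(P y) creates a new first argument, the singleton block at the head; the
    Leibniz rule gives the terms in which [n] joins a block. *)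
Lemma is_derive_chain_term p n y : N y ->
  is_derive (y n) 1 (fun t => chain_term p (dfwith y n t))
    (\sum_(q <- add_letter n p) chain_term q y).
Proof.
move=> Ny; have yE := dfwith_id y n.
have AD k : is_derive (y n) 1 (fun t => frechetD M k (P (dfwith y n t)))
    (bmcurry (frechetD M k.+1 (P y)) (partials [:: n] P y)).
  have dM : differentiable (frechetD M k) (P (dfwith y n (y n))).
    by rewrite yE; apply: M_smooth; exact: Ny.2.
  rewrite curry_frechetD; last by apply: M_smooth; exact: Ny.2.
  have := is_derive_comp dM (is_derive_partials [::] n Ny).
  by rewrite yE.
have gD w : is_derive (y n) 1 (fun t => partials w P (dfwith y n t))
    (partials (n :: w) P (dfwith y n (y n))).
  by rewrite yE; exact: is_derive_partials.
have := @is_derive_mapply _ _ _ _ (fun t w => partials w P (dfwith y n t)) (cons n) p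
  (fun t k => frechetD M k (P (dfwith y n t))) _ (y n) AD gD.
by rewrite yE big_cons.
Qed.

(** The induction step of [faa_di_bruno], kept apart because it also yields the existence of the
    next partial derivative. *)
Lemma chain_term_sum_derive w n y : N y ->
  (forall z, N z -> partials w Q z = \sum_(p <- word_partitions w) chain_term p z) ->
  is_derive (y n) 1 (fun t => partials w Q (dfwith y n t))
    (\sum_(p <- word_partitions (n :: w)) chain_term p y).
Proof.
move=> Ny wE.
have D : is_derive (y n) 1
    (fun t => \sum_(p <- word_partitions w) chain_term p (dfwith y n t))
    (\sum_(p <- word_partitions (n :: w)) chain_term p y).
  rewrite word_partitions_sum; elim: (word_partitions w) => [|p r IH].
    rewrite big_nil; under eq_fun do rewrite big_nil; exact: is_derive_cst.
  rewrite big_cons; under eq_fun do rewrite big_cons.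
  exact: is_deriveD (is_derive_chain_term p n Ny) IH.
(* The formula is available on [N] only, and near [y] the coordinate line stays in [N]. *)
apply: near_eq_is_derive D; near=> t; apply/esym/wE; near: t.
exact: near_dfwith.
Unshelve. all: by end_near. Qed.

Lemma faa_di_bruno w y : N y ->
  partials w Q y = \sum_(p <- word_partitions w) chain_term p y.
Proof.
elim: w y => [|n w IH] y Ny.
  by rewrite [word_partitions _]/= big_seq1 /chain_term [mapply _ _ _]/= frechetD0E.
rewrite /= /partial derive1E.
exact: @derive_val _ _ _ _ _ _ _ (chain_term_sum_derive n Ny IH).
Qed.

Lemma partials_comp_cons w w' n y : N y ->
  (forall z, N z -> partials w Q z = partials w' Q z) ->
  partials (n :: w) Q y = partials (n :: w') Q y.
Proof.
move=> Ny ww'; rewrite /= /partial !derive1E; apply: near_eq_derive.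
by near=> t; apply: ww'; near: t; exact: near_dfwith.
Unshelve. all: by end_near. Qed.

(** This is [second_diff_sym] for D^k M. Only the two leading arguments are exchanged, as a swap of
    two new singleton blocks requires. *)
Lemma frechetD_sym k x u v : NM x ->
  bmcurry (bmcurry (frechetD M k.+2 x) u) v =
  bmcurry (bmcurry (frechetD M k.+2 x) v) u.
Proof.
move=> NMx.
have nNM : \forall z \near x, NM z by exact: open_nbhs_nbhs (conj NM_open NMx).
pose Fd (h : X) (z : X) := bmcurry (frechetD M k.+1 z) h.
have dcurry h z : NM z -> is_diff z (Fd h) (fun a => bmcurry ('d (frechetD M k.+1) z a) h).
  move=> NMz; have dM := M_smooth k.+1 NMz.
  have dc := is_diff_bmcurryl h (frechetD M k.+1 z).
  apply: DiffDef; first exact: (differentiable_comp dM (@ex_diff _ _ _ _ _ _ _ dc)).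
  by rewrite (diff_comp dM (@ex_diff _ _ _ _ _ _ _ dc)) diff_val.
have FdE h a z : NM z -> 'd (Fd h) z a = bmcurry (bmcurry (frechetD M k.+2 z) a) h.
  move=> NMz; have := dcurry h z NMz => ?.
  by rewrite diff_val curry_frechetD//; exact: M_smooth.
(* Continuity comes from the differentiability of D^(k+2) M, followed by two continuous linear
   curryings. *)
have cont h a : {for x, continuous (fun z => 'd (Fd h) z a)}.
  have cc : {for x, continuous (fun z => bmcurry (bmcurry (frechetD M k.+2 z) a) h)}.
    apply: differentiable_continuous.
    have d1 := @ex_diff _ _ _ _ _ _ _ (is_diff_bmcurryl a (frechetD M k.+2 x)).
    have d2 := @ex_diff _ _ _ _ _ _ _
      (is_diff_bmcurryl h (bmcurry (frechetD M k.+2 x) a)).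
    exact: differentiable_comp (differentiable_comp (M_smooth k.+2 NMx) d1) d2.
  rewrite /prop_for /continuous_at FdE//; apply: cvg_trans cc; apply: near_eq_cvg.
  by near=> z; rewrite FdE//; near: z.
rewrite -FdE// -[RHS]FdE//.
apply/esym/(@second_diff_sym _ _ _ (frechetD M k)) => //.
- near=> z; have NMz : NM z by near: z.
  by split; rewrite /Fd ?curry_frechetD//; exact: M_smooth.
- near=> z; have NMz : NM z by near: z.
  by split; [have := dcurry u z NMz | have := dcurry v z NMz] => ?.
Unshelve. all: by end_near. Qed.

(** After the expansion by [faa_di_bruno], [add_letter_exchange] matches the terms that stem from
    each partition of [w]. *)
Lemma partials_comp_swap a b w y : N y ->
  partials (a :: b :: w) Q y = partials (b :: a :: w) Q y.
Proof.
move=> Ny; rewrite !faa_di_bruno// !word_partitions_sum.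
apply: eq_bigr => p _.
apply: (@add_letter_exchange _ _ (chain_term^~ y)).
  rewrite /chain_term/=; apply: eq_mapply => k; exact: frechetD_sym Ny.2.
move=> s1 c s2; apply: eq_mapply_arg.
apply: P_partials.2; [exact: Ny.1 | exact: permEl (perm_catCA [:: a] [:: b] c)].
Qed.

Lemma partials_comp_move u n v y : N y ->
  partials (u ++ n :: v) Q y = partials (n :: u ++ v) Q y.
Proof.
elim: u y => [//|m u IH] y Ny.
by rewrite -partials_comp_swap//; apply: partials_comp_cons.
Qed.

Lemma has_mixed_partials_comp : has_mixed_partials N Q.
Proof.
split=> [w n y Ny|].
  exact: @ex_derive _ _ _ _ _ _ _ (chain_term_sum_derive n Ny (@faa_di_bruno w)).
elim=> [w' y Ny|n w IH w' y Ny pw]; first by rewrite perm_sym => /perm_nilP->.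
(* The first letter of the one word is located in [w'] and moved to the front, which leaves a
   permutation of the remaining letters. *)
have nw' : n \in w' by rewrite -(perm_mem pw) mem_head.
have [u [v w'E]] : exists u v, w' = u ++ n :: v by case/splitPr: nw' => u v; exists u, v.
move: pw; rewrite w'E partials_comp_move// -[in X in perm_eq _ X]cat1s perm_sym perm_catCA.
rewrite /= perm_cons perm_sym => pw.
by apply: partials_comp_cons => // z Nz; exact: IH.
Qed.

End ChainRule.

(** * Gevrey bounds for the composition *)

Lemma gevrey_mixed_comp {R : realType} {X Y : normedModType R}
    (P : {ptws Npos -> R} -> X) (M : X -> Y) (gamma : Npos -> R) (sP sM s : R)
    (NP : set {ptws Npos -> R}) (NM : set X) (muP nuP muM nuM : R) :
  open NP -> open NM -> sP <= s -> sM <= s -> 1 <= s ->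
  0 <= muP -> 0 <= muM -> 0 <= nuM ->
  gevrey_mixed_on sP gamma NP muP nuP P -> gevrey_on sM NM muM nuM M ->
  gevrey_mixed_on s gamma (NP `&` P @^-1` NM) (muM * (nuM * muP / (nuM * muP + 1)))
    ((nuM * muP + 1) * nuP) (M \o P).
Proof.
move=> NP_open NM_open sPs sMs s1 muP0 muM0 nuM0 PG [M_smooth Mb].
split; first exact: (has_mixed_partials_comp NP_open NM_open PG.1 M_smooth).
move=> alpha a0; have w0 := mi_word_gt0 a0.
apply: ge_ereal_sup => _ [y Ny <-]; rewrite lee_fin.
rewrite /mixed_partial -/(mi_word alpha) -size_mi_word -prod_mi_word.
move: (mi_word alpha) w0 => w w0.
rewrite (faa_di_bruno NP_open NM_open PG.1 M_smooth w Ny).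
have Pb b : (0 < size b)%N -> `|partials b P y| <=
    (size b)`!%:R `^ sP * muP * nuP ^+ size b * \prod_(n <- b) gamma n.
  exact: gevrey_word_bound PG Ny.1.
apply: le_trans (ler_norm_sum _ _ _) _.
apply: le_trans _ (gevrey_partition_sum sPs sMs _ _ _ _ _ _) => //.
  rewrite !big_seq; apply: ler_sum => p pw; apply: le_trans (mapply_norm _ _ _) _.
  apply: ler_pM => //; first by apply: prodr_ge0.
    have /ereal_supP/(_ (`|frechetD M (size p) (P y)|)%:E) :=
      Mb _ (word_partitions_size_gt0 w0 pw).
    rewrite lee_fin; apply; exists (P y) => //; exact: Ny.2.
  (* Blocks are nonempty, so the bound for [P], which excludes the multi-index 0, applies to each of
     them. *)
  rewrite !big_seq; apply: ler_prod => b bp; rewrite normr_ge0/= Pb// lt0n size_eq0.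
  by apply: contraNneq (word_partitions_nil pw) => <-.
(* The sign hypothesis of [gevrey_partition_sum]: the bound [Pb] for [w] dominates a norm, and its
   power of a factorial is positive. *)
have := le_trans (normr_ge0 _) (Pb w w0).
rewrite -!mulrA pmulr_rge0//; exact: powR_gt0.
Qed.

Theorem theorem8 (R : realType) (X Y : completeNormedModType R)
    (DP : set {ptws Npos -> R}) (DM : set X)
    (P : {ptws Npos -> R} -> X) (M : X -> Y)
    (y0 : {ptws Npos -> R}) (gamma : Npos -> R) (sP sM : R)
    (NP : set {ptws Npos -> R}) (NM : set X) (muP nuP muM nuM : R)
    (DP_open : open DP) (DM_open : open DM) (P_maps : P @` DP `<=` DM)
    (y0_DP : DP y0)
    (sP_ge1 : 1 <= sP) (sM_ge1 : 1 <= sM)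
    (NP_open : open NP) (NP_y0 : NP y0) (NP_sub : NP `<=` DP)
    (NM_open : open NM) (NM_x0 : NM (P y0)) (NM_sub : NM `<=` DM)
    (muP_ge0 : 0 <= muP) (nuP_ge0 : 0 <= nuP)
    (muM_ge0 : 0 <= muM) (nuM_ge0 : 0 <= nuM)
    (P_gevrey : gevrey_mixed_on sP gamma NP muP nuP P)
    (M_gevrey : gevrey_on sM NM muM nuM M) :
  let s := Num.max sP sM in
  let N := NP `&` P @^-1` NM in
  let mu := muM * (nuM * muP / (nuM * muP + 1)) in
  let nu := (nuM * muP + 1) * nuP in
  ({for y0, continuous P} -> gevrey_mixed_at s gamma DP y0 (M \o P)) /\
  gevrey_mixed_on s gamma N mu nu (M \o P).
Proof.
move=> s N mu nu.
have QG : gevrey_mixed_on s gamma N mu nu (M \o P).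
  apply: (gevrey_mixed_comp NP_open NM_open _ _ _ _ _ _ P_gevrey M_gevrey) => //.
  - by rewrite le_max lexx.
  - by rewrite le_max lexx orbT.
  - by rewrite le_max sP_ge1.
(* The neighbourhood must be open in the product topology, hence the interior; continuity of [P] at
   [y0] puts [y0] into it. *)
split=> // cP; exists (NP `&` (P @^-1` NM)^°); split.
- by apply: openI => //; exact: open_interior.
- by split=> //; apply: cP; exact: open_nbhs_nbhs (conj NM_open NM_x0).
- by move=> y [/NP_sub].
- exists mu, nu; split.
  + by rewrite /mu mulr_ge0// divr_ge0 ?addr_ge0 ?mulr_ge0.
  + by rewrite /nu mulr_ge0 ?addr_ge0 ?mulr_ge0.
  + apply: gevrey_mixed_onS QG => y [NPy /interior_subset Py]; by split.
Qed.
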